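(* For every $k\ge 2$, ${\rm FO}(\subseteq)(k{-}1\mbox{-inc}) < {\rm FO}(\subseteq)(k\mbox{-inc})$; that is, every sentence of ${\rm FO}(\subseteq)(k{-}1\mbox{-inc})$ is logically equivalent to a sentence of ${\rm FO}(\subseteq)(k\mbox{-inc})$ over the same signature, but there is a signature $\tau$ and a sentence of ${\rm FO}(\subseteq)(k\mbox{-inc})[\tau]$ that is not logically equivalent to any sentence of ${\rm FO}(\subseteq)(k{-}1\mbox{-inc})[\tau]$.
   Context: Inclusion logic ${\rm FO}(\subseteq)$ over a signature $\tau$ consists of formulae in negation normal form generated by $\phi ::= \bar x_1 \subseteq \bar x_2 \mid t_1 = t_2 \mid \neg t_1 = t_2 \mid R(\bar t) \mid \neg R(\bar t) \mid (\phi \wedge \psi) \mid (\phi \vee \psi) \mid \forall x \phi \mid \exists x \phi$, where in an inclusion atom $\bar x_1 \subseteq \bar x_2$ the tuples $\bar x_1,\bar x_2$ are tuples of variables of the same length. Models are assumed to have at least two elements. A team $X$ over a model $\mathfrak{M}$ with domain $M$ is a set of assignments with a common finite domain of variables. Lax team semantics: for a first-order literal $\alpha$, $\mathfrak{M}\models_X \alpha$ iff every $s\in X$ satisfies $\alpha$ in the usual Tarskian sense; $\mathfrak{M}\models_X \bar x_1\subseteq \bar x_2$ iff for every $s\in X$ there is $s'\in X$ with $s(\bar x_1)=s'(\bar x_2)$; $\mathfrak{M}\models_X\phi\wedge\psi$ iff $\mathfrak{M}\models_X\phi$ and $\mathfrak{M}\models_X\psi$; $\mathfrak{M}\models_X\phi\vee\psi$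 iff there are teams $Y,Z$ with $Y\cup Z=X$, $\mathfrak{M}\models_Y\phi$ and $\mathfrak{M}\models_Z\psi$; $\mathfrak{M}\models_X\exists x\phi$ iff $\mathfrak{M}\models_{X[F/x]}\phi$ for some function $F:X\to\mathcal{P}(M)\setminus\{\emptyset\}$, where $X[F/x]=\{s(a/x)\mid s\in X, a\in F(s)\}$; $\mathfrak{M}\models_X\forall x\phi$ iff $\mathfrak{M}\models_{X[M/x]}\phi$, where $X[M/x]=\{s(a/x)\mid s\in X,a\in M\}$. A sentence $\phi$ is true in $\mathfrak{M}$ iff $\mathfrak{M}\models_{\{\emptyset\}}\phi$. Two sentences are logically equivalent if they are true in exactly the same models. ${\rm FO}(\subseteq)(k\mbox{-inc})$ denotes the formulae of ${\rm FO}(\subseteq)$ in which only inclusion atoms $\bar x_1\subseteq\bar x_2$ with $|\bar x_1|=|\bar x_2|\le k$ occur. For logics $\mathcal{L},\mathcal{L}'$, $\mathcal{L}\le\mathcal{L}'$ means that for every signature $\tau$ every $\mathcal{L}[\tau]$-sentence is logically equivalent to some $\mathcal{L}'[\tau]$-sentence, and $\mathcal{L}<\mathcal{L}'$ means $\mathcal{L}\le\mathcal{L}'$ but not $\mathcal{L}'\le\mathcal{L}$. *)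

(* Defs.v *)
From Stdlib Require Import List Arith.
Import ListNotations.
Set Implicit Arguments.

Record signature := {
  rsym : Type; rar : rsym -> nat;
  fsym : Type; far : fsym -> nat }.

Section Syntax.
Variable tau : signature.

Inductive term : Type :=
| TVar : nat -> term
| TApp : fsym tau -> list term -> term.

Inductive formula : Type :=
| FInc : list nat -> list nat -> formula
| FEq : term -> term -> formula
| FNEq : term -> term -> formula
| FRel : rsym tau -> list term -> formula
| FNRel : rsym tau -> list term -> formula
| FAnd : formula -> formula -> formula
| FOr : formula -> formula -> formula
| FAll : nat -> formula -> formula
| FEx : nat -> formula -> formula.

Fixpoint wf_term (t : term) : Prop :=
  match t with
  | TVar _ => True
  | TApp f ts => length ts = far tau f /\
      (fix go (l : list term) : Prop :=
         match l with nil => True | t :: l => wf_term t /\ go l end) ts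
  end.

Definition wf_terms (l : list term) : Prop := Forall wf_term l.

Fixpoint wf (phi : formula) : Prop :=
  match phi with
  | FInc xs ys => length xs = length ys
  | FEq t1 t2 | FNEq t1 t2 => wf_term t1 /\ wf_term t2
  | FRel R ts | FNRel R ts => length ts = rar tau R /\ wf_terms ts
  | FAnd p q | FOr p q => wf p /\ wf q
  | FAll _ p | FEx _ p => wf p
  end.

Fixpoint inc_bound (k : nat) (phi : formula) : Prop :=
  match phi with
  | FInc xs ys => length xs <= k
  | FAnd p q | FOr p q => inc_bound k p /\ inc_bound k q
  | FAll _ p | FEx _ p => inc_bound k p
  | _ => True
  end.

Fixpoint occurs_term (x : nat) (t : term) : Prop :=
  match t with
  | TVar y => x = y
  | TApp _ ts =>
      (fix go (l : list term) : Prop :=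
         match l with nil => False | t :: l => occurs_term x t \/ go l end) ts
  end.

Fixpoint free (x : nat) (phi : formula) : Prop :=
  match phi with
  | FInc xs ys => In x xs \/ In x ys
  | FEq t1 t2 | FNEq t1 t2 => occurs_term x t1 \/ occurs_term x t2
  | FRel _ ts | FNRel _ ts => Exists (occurs_term x) ts
  | FAnd p q | FOr p q => free x p \/ free x q
  | FAll y p | FEx y p => x <> y /\ free x p
  end.

Definition sentence (phi : formula) : Prop := forall x, ~ free x phi.

Definition FOinc_sentence (k : nat) (phi : formula) : Prop :=
  wf phi /\ sentence phi /\ inc_bound k phi.

End Syntax.

Arguments TVar {tau}.
Arguments TApp {tau}.
Arguments FInc {tau}.
Arguments FEq {tau}.
Arguments FNEq {tau}.
Arguments FRel {tau}.
Arguments FNRel {tau}.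
Arguments FAnd {tau}.
Arguments FOr {tau}.
Arguments FAll {tau}.
Arguments FEx {tau}.

Record model (tau : signature) := {
  carrier : Type;
  relI : rsym tau -> list carrier -> Prop;
  funI : fsym tau -> list carrier -> carrier;
  two_elems : exists a b : carrier, a <> b }.

Section Semantics.
Variable tau : signature.
Variable M : model tau.

Definition assignment := nat -> option (carrier M).
Definition team := assignment -> Prop.

Definition empty_asg : assignment := fun _ => None.

Definition update (s : assignment) (x : nat) (a : carrier M) : assignment :=
  fun y => if Nat.eqb y x then Some a else s y.

Fixpoint eval (s : assignment) (t : term tau) : option (carrier M) :=
  match t with
  | TVar x => s x
  | TApp f ts =>
      match (fix go (l : list (term tau)) : option (list (carrier M)) :=
               match l with
               | nil => Some nil
               | t :: l => match eval s t, go l with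
                           | Some a, Some r => Some (a :: r)
                           | _, _ => None end
               end) ts with
      | Some args => Some (funI M f args)
      | None => None
      end
  end.

Fixpoint evals (s : assignment) (l : list (term tau)) : option (list (carrier M)) :=
  match l with
  | nil => Some nil
  | t :: l => match eval s t, evals s l with
              | Some a, Some r => Some (a :: r)
              | _, _ => None end
  end.

Fixpoint sat (X : team) (phi : formula tau) : Prop :=
  match phi with
  | FInc xs ys =>
      forall s, X s -> exists s', X s' /\ map s xs = map s' ys
  | FEq t1 t2 =>
      forall s, X s -> exists a, eval s t1 = Some a /\ eval s t2 = Some a
  | FNEq t1 t2 =>
      forall s, X s -> exists a b, eval s t1 = Some a /\ eval s t2 = Some b /\ a <> b
  | FRel R ts =>
      forall s, X s -> exists l, evals s ts = Some l /\ relI M R l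
  | FNRel R ts =>
      forall s, X s -> exists l, evals s ts = Some l /\ ~ relI M R l
  | FAnd p q => sat X p /\ sat X q
  | FOr p q =>
      exists Y Z : team, (forall s, X s <-> (Y s \/ Z s)) /\ sat Y p /\ sat Z q
  | FAll x p =>
      sat (fun s' => exists s a, X s /\ s' = update s x a) p
  | FEx x p =>
      exists F : assignment -> carrier M -> Prop,
        (forall s, X s -> exists a, F s a) /\
        sat (fun s' => exists s a, X s /\ F s a /\ s' = update s x a) p
  end.

Definition true_in (phi : formula tau) : Prop := sat (fun s => s = empty_asg) phi.

End Semantics.

Definition equivalent (tau : signature) (phi psi : formula tau) : Prop :=
  forall M : model tau, true_in M phi <-> true_in M psi.

(* Main.v *)
(** The separating sentence says that a digraph on [k]-tuples has an infinite path:
    [exists x y, E(x, y) /\ y ⊆ x] with [x], [y] of length [k].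

    The models are generic: every duplicate-free [k]-tuple has a colour, and every assignment of
    colours to the new [k]-tuples over a finite set is realised by some new element. The colours
    form a graph with edges [c -> c - 1], and [E(x, y)] holds when the colours of [x], [y] are
    joined by an edge. With colours in [nat] there is no infinite path, with colours in [nat + Z]
    there is one. Tuples of length [< k] have no colour, so in a generic model any two of them with
    the same equalities are conjugate.

    By an Ehrenfeucht-Fraisse argument a sentence [psi] with atoms of arity [< k] passes from the
    second model to the first: to a team [X] over the second model corresponds a team [Y] over the
    first that matches [X] up to [r] rounds of the game and is closed under partial isomorphism.
    An inclusion atom survives because a witness in [Y] matching the right equalities can be moved,
    by conjugacy of [(k-1)]-tuples, to one with the prescribed values, without loss of rounds. *)

Require Import Defs.
From Stdlib Require Import List Arith ZArith Lia Classical ClassicalEpsilon FunctionalExtensionality PropExtensionality.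
Import ListNotations.

(** * Chains of colours with partial integer offsets *)

Local Open Scope Z_scope.

(** [off a b z] reads: [b] lies [z] steps after [a]. It is a relation because points of different
    components have no offset and steps below [org] do not exist; by [off_ex], falling below [org]
    is the only obstruction to a step. *)
Record chain := {
  pt :> Type;
  off : pt -> pt -> Z -> Prop;
  org : pt;
  off_refl : forall a z, off a a z <-> z = 0;
  off_eq : forall a b, off a b 0 -> a = b;
  off_sym : forall a b z, off a b z -> off b a (- z);
  off_trans : forall a b c y z, off a b y -> off b c z -> off a c (y + z);
  off_ex : forall a z, (exists b, off a b z) \/ (exists j, off org a j /\ j + z < 0);
  off_org : forall a j, off org a j -> 0 <= j;
  off_far : forall (l : list pt) m,
    exists a, forall b z, In b l -> Z.abs z <= m -> ~ off b a z }.

Arguments off {_}.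
Arguments org {_}.

Lemma nat_list_bound (l : list nat) : exists N, forall b, In b l -> (b <= N)%nat.
Proof.
  induction l as [|a l [N HN]].
  - exists 0%nat; intros b [].
  - exists (Nat.max a N); intros b [<-|Hb]; [lia|specialize (HN _ Hb); lia].
Qed.

Definition half_line : chain.
Proof.
  refine {| pt := nat; off := fun a b z => Z.of_nat b = Z.of_nat a + z; org := 0%nat |};
    try (intros; lia).
  - intros a z. destruct (Z_lt_le_dec (Z.of_nat a + z) 0).
    + right; exists (Z.of_nat a); lia.
    + left; exists (Z.to_nat (Z.of_nat a + z)); lia.
  - intros l m. destruct (nat_list_bound l) as [N HN].
    exists (N + Z.to_nat m + 1)%nat; intros b z Hb Hz. specialize (HN _ Hb); lia.
Defined.

Definition half_line_plus_line : chain.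
Proof.
  refine {| pt := (nat + Z)%type;
            off := fun a b z => match a, b with
                                | inl a, inl b => Z.of_nat b = Z.of_nat a + z
                                | inr a, inr b => b = a + z
                                | _, _ => False end;
            org := inl 0%nat |}.
  - intros [a|a] z; lia.
  - intros [a|a] [b|b] H; try contradiction; f_equal; lia.
  - intros [a|a] [b|b] z H; lia.
  - intros [a|a] [b|b] [c|c] y z H1 H2; lia.
  - intros [a|a] z.
    + destruct (Z_lt_le_dec (Z.of_nat a + z) 0).
      * right; exists (Z.of_nat a); lia.
      * left; exists (inl (Z.to_nat (Z.of_nat a + z))); lia.
    + left; exists (inr (a + z)); lia.
  - intros [a|a] j H; lia.
  - intros l m.
    destruct (nat_list_bound (map (fun c => match c with inl a => a | inr _ => 0%nat end) l))
      as [N HN].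
    exists (inl (N + Z.to_nat m + 1)%nat); intros [b|b] z Hb Hz; [|tauto].
    specialize (HN b (in_map _ _ _ Hb)); lia.
Defined.

(** * Back-and-forth between chains up to bounded distance *)

Section ChainGame.
Context {T1 T2 : chain}.

(** A list of pairs suffices: for [0 <= m], the offset 0 already forces equal points to have equal
    partners, and conversely. *)
Definition near_iso (m : Z) (l : list (T1 * T2)) : Prop :=
  forall a a' b b' z, In (a, a') l -> In (b, b') l -> Z.abs z <= m ->
    (off a b z <-> off a' b' z).

Lemma near_iso_sub m m' l l' :
  m' <= m -> incl l' l -> near_iso m l -> near_iso m' l'.
Proof. intros Hm Hi H a a' b b' z Ha Hb Hz; apply H; auto; lia. Qed.

(* A point at distance at most [m] from the old ones is copied with its offset;
   any other point is sent far away from everything. *)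
Lemma near_iso_extend m l a :
  0 <= m -> near_iso (2 * m) l -> In (org, org) l ->
  exists a', near_iso m ((a, a') :: l).
Proof.
  intros Hm H Ho.
  assert (Hsuff : forall a', (forall c c' y, In (c, c') l -> Z.abs y <= m ->
            (off a c y <-> off a' c' y)) -> near_iso m ((a, a') :: l)).
  { intros a' Ha c c' d d' z [E|Hc] [F|Hd] Hz;
      try injection E as <- <-; try injection F as <- <-.
    - rewrite !off_refl; tauto.
    - auto.
    - split; intros G; apply off_sym in G; apply (Ha c c') in G; auto; try lia;
        apply off_sym in G; rewrite Z.opp_involutive in G; exact G.
    - apply H; auto; lia. }
  destruct (classic (exists b b' z, In (b, b') l /\ Z.abs z <= m /\ off b a z))
    as [(b & b' & z & Hb & Hz & Hba)|Hfar].
  - destruct (off_ex _ b' z) as [[a' Ha']|[j [Hj Hneg]]].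
    + exists a'; apply Hsuff; intros c c' y Hc Hy.
      split; intros G.
      (* Going through [b] adds two offsets of size at most [m], hence the precision [2 * m] for the
         old list. *)
      * pose proof (off_trans _ _ _ _ _ _ Hba G) as K.
        apply (H b b' c c' (z + y)) in K; auto; [|lia].
        pose proof (off_trans _ _ _ _ _ _ (off_sym _ _ _ _ Ha') K) as K'.
        replace (- z + (z + y)) with y in K' by lia; exact K'.
      * pose proof (off_trans _ _ _ _ _ _ Ha' G) as K.
        apply (H b b' c c' (z + y)) in K; auto; [|lia].
        pose proof (off_trans _ _ _ _ _ _ (off_sym _ _ _ _ Hba) K) as K'.
        replace (- z + (z + y)) with y in K' by lia; exact K'.
    (* Suppose the copied step falls below the origin of [T2]. The origins are matched and [j] is
       less than [m], so [a] would lie below the origin of [T1]. *)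
    + exfalso. pose proof (off_org _ _ _ Hj).
      apply (H org org b b' j) in Hj; auto; [|lia].
      pose proof (off_org _ _ _ (off_trans _ _ _ _ _ _ Hj Hba)); lia.
  - destruct (off_far _ (map snd l) m) as [a' Ha']. exists a'; apply Hsuff.
    intros c c' y Hc Hy; split; intros G; exfalso; apply off_sym in G.
    + apply Hfar; exists c, c', (- y); repeat split; auto; lia.
    + apply (Ha' c' (- y)) in G; auto; [|lia].
      apply in_map_iff; exists (c, c'); auto.
Qed.

(** Each added point halves the precision. Answers are filed under the keys [us], not under the
    points [f u], since each becomes the colour of the tuple that its key describes. *)
Lemma near_iso_extend_list {K : Type} (f : K -> T1) (us : list K) m l :
  0 <= m -> near_iso (2 ^ Z.of_nat (length us) * m) l -> In (org, org) l ->
  exists l' : list (K * T2), map fst l' = us /\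
    near_iso m (map (fun e => (f (fst e), snd e)) l' ++ l).
Proof.
  revert m; induction us as [|u us IH]; intros m Hm H Ho.
  - exists []; split; auto. change (near_iso (1 * m) l) in H.
    rewrite Z.mul_1_l in H; exact H.
  - destruct (IH (2 * m)) as (l' & E & H'); auto; [lia| |].
    + simpl length in H; rewrite Nat2Z.inj_succ, Z.pow_succ_r in H by lia.
      eapply near_iso_sub; [|apply incl_refl|exact H]; lia.
    + destruct (near_iso_extend m _ (f u) Hm H') as [t Ht].
      { apply in_or_app; auto. }
      exists ((u, t) :: l'); simpl; split; [congruence|exact Ht].
Qed.

End ChainGame.

(** * Generic colourings *)

Definition fill {D : Type} (d : D) (o : option D) : D :=
  match o with Some e => e | None => d end.

Lemma map_fill_inj {D : Type} (d : D) key key' :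
  ~ In (Some d) key -> ~ In (Some d) key' ->
  map (fill d) key = map (fill d) key' -> key = key'.
Proof.
  revert key'; induction key as [|x key IH]; intros [|x' key'] H H' E;
    try discriminate; auto.
  injection E as E1 E2. f_equal.
  - destruct x as [e|], x' as [e'|]; simpl in *; subst; intuition congruence.
  - apply IH; simpl in *; tauto.
Qed.

(* A list of type [list (option D)] is a tuple in which [None] stands for the new element. *)
Definition generic {D T : Type} (col : list D -> T) : Prop :=
  forall (S : list D) (l : list (list (option D) * T)),
    (forall key t e, In (key, t) l -> In (Some e) key -> In e S) ->
    (forall key t t', In (key, t) l -> In (key, t') l -> t = t') ->
    exists d, ~ In d S /\
      forall key t, In (key, t) l -> In None key -> col (map (fill d) key) = t.

(** * Construction of a generic colouring *)

Section Tree.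
Variables (T : Type) (o : T).

(** An element is a finite table of colours it prescribes for tuples through itself, with [None]
    marking its own places and previously built elements in the others. Every finite demand can thus
    be made into an element that meets it. *)
Inductive tree : Type := Node : list (list (option tree) * T) -> tree.

Definition table (d : tree) := let 'Node tb := d in tb.

Fixpoint size (d : tree) : nat :=
  match d with
  | Node tb =>
      S ((fix size_table tb := match tb with
          | [] => 0
          | (key, _) :: tb =>
              (fix size_key key := match key with
                | [] => 0
                | None :: key => size_key key
                | Some e :: key => size e + size_key key
                end) key + size_table tb
          end) tb)%nat
  end.

Lemma size_table_lt d key t e :
  In (key, t) (table d) -> In (Some e) key -> (size e < size d)%nat.
Proof.
  destruct d as [tb]; simpl; intros H He. apply le_n_S.
  induction tb as [|[key' t'] tb IH]; [contradiction|].
  destruct H as [E|H].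
  - injection E as -> ->. clear IH.
    match goal with |- (_ <= ?a + ?b)%nat => enough (size e <= a)%nat by lia end.
    induction key as [|[e'|] key IH]; [contradiction| |].
    + destruct He as [E|He]; [injection E as ->; lia|specialize (IH He); lia].
    + destruct He as [E|He]; [discriminate|auto].
  - specialize (IH H); lia.
Qed.

Definition declares (d : tree) (w : list tree) (t : T) : Prop :=
  exists key, In (key, t) (table d) /\ In None key /\ w = map (fill d) key.

(** Tables need not be functional and some tuples are declared by no element, so [epsilon] picks
    some declared colour, or an arbitrary one if there is none. *)
Definition colour (w : list tree) : T :=
  epsilon (inhabits o) (fun t => exists d, declares d w t).

(** The declaring element is the strictly largest entry of the tuple, so two different elements
    never declare colours for the same tuple. *)
Lemma declares_size d w t e : declares d w t -> In e w -> e = d \/ (size e < size d)%nat.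
Proof.
  intros (key & Hk & _ & ->) He. apply in_map_iff in He as ([e'|] & <- & Hi); simpl; auto.
  right; eapply size_table_lt; eauto.
Qed.

Lemma declares_in d w t : declares d w t -> In d w.
Proof. intros (key & _ & Hn & ->). apply in_map_iff; exists None; auto. Qed.

Lemma colour_generic : generic colour.
Proof.
  intros S l HS Hf.
  (* The first entry contains no [None]: it declares nothing and only makes [d] larger than [S]. *)
  set (d := Node ((map Some S, o) :: l)).
  assert (Hd : forall e, In e S -> (size e < size d)%nat).
  { intros e He. apply (size_table_lt d (map Some S) o); simpl; auto.
    apply in_map; auto. }
  assert (Hdk : forall key t, In (key, t) l -> ~ In (Some d) key).
  { intros key t Hk Hi. apply HS with (1 := Hk), Hd in Hi; lia. }
  exists d; split; [intros Hi; apply Hd in Hi; lia|].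
  intros key t Hk Hn.
  assert (Hdec : declares d (map (fill d) key) t) by (exists key; simpl; auto).
  assert (Hc : exists d', declares d' (map (fill d) key) (colour (map (fill d) key))).
  { unfold colour; apply epsilon_spec; eauto. }
  destruct Hc as [d' Hc].
  (* Both [d] and the declaring [d'] occur in the tuple; if they differed, each would be smaller
     than the other. If they coincide, the keys coincide as well, since [d] is not in its own
     keys. *)
  destruct (declares_size _ _ _ _ Hdec (declares_in _ _ _ Hc)) as [->|H1].
  - destruct Hc as (key' & [E|Hk'] & Hn' & E').
    + injection E as <- _. apply in_map_iff in Hn' as (? & ? & _); discriminate.
    + apply map_fill_inj in E'; [subst key'|eauto|eauto]. symmetry; eauto.
  - destruct (declares_size _ _ _ _ Hc (declares_in _ _ _ Hdec)) as [->|H2]; lia.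
Qed.

End Tree.

(** * Words, keys and partial bijections *)

Fixpoint words {K : Type} (n : nat) (q : list K) : list (list K) :=
  match n with
  | O => [[]]
  | S n => flat_map (fun x => map (cons x) (words n q)) q
  end.

Lemma in_words {K : Type} n (q u : list K) :
  In u (words n q) <-> length u = n /\ incl u q.
Proof.
  revert u; induction n as [|n IH]; intros u; simpl.
  - split.
    + intros [<-|[]]; split; [auto|apply incl_nil_l].
    + intros [H _]; destruct u; [auto|discriminate].
  - rewrite in_flat_map; split.
    + intros (x & Hx & Hu). apply in_map_iff in Hu as (v & <- & Hv).
      apply IH in Hv as [Hl Hi]. simpl; split; [lia|apply incl_cons; auto].
    + intros [Hl Hi]. destruct u as [|x u]; [discriminate|].
      apply incl_cons_inv in Hi as [Hx Hi]. exists x; split; auto.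
      apply in_map, IH; auto.
Qed.

Lemma length_words {K : Type} n (q : list K) : length (words n q) = (length q ^ n)%nat.
Proof.
  induction n as [|n IH]; simpl; auto.
  rewrite flat_map_constant_length with (c := (length q ^ n)%nat); [lia|].
  intros; rewrite length_map; auto.
Qed.

(** Sorts the tuples over an extended position: with [None] in the key the colour is still to be
    arranged, without it the tuple is an old one. *)
Lemma words_key {K : Type} (e : K) p u :
  incl u (e :: p) ->
  exists key, incl key (None :: map Some p) /\ u = map (fill e) key /\
    (~ In None key -> incl u p).
Proof.
  induction u as [|x u IH]; intros H.
  - exists []; auto using incl_nil_l.
  - apply incl_cons_inv in H as [Hx Hu]. destruct (IH Hu) as (key & Hk & -> & Hn).
    destruct Hx as [<-|Hx].
    + exists (None :: key); repeat split; simpl; [|tauto].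
      apply incl_cons; simpl; auto.
    + exists (Some x :: key); repeat split; simpl.
      * apply incl_cons; auto. right; apply in_map; auto.
      * intros G; apply incl_cons; auto.
Qed.

Definition bij {A B : Type} (p : list (A * B)) : Prop :=
  forall a b a' b', In (a, b) p -> In (a', b') p -> (a = a' <-> b = b').

Lemma bij_sub {A B : Type} (p p' : list (A * B)) : incl p' p -> bij p -> bij p'.
Proof. intros Hi H a b a' b' ? ?; apply H; auto. Qed.

Lemma bij_NoDup {A B : Type} (p u : list (A * B)) :
  bij p -> incl u p -> (NoDup (map fst u) <-> NoDup (map snd u)).
Proof.
  intros Hb; induction u as [|[a b] u IH]; intros Hi; simpl.
  - split; constructor.
  - apply incl_cons_inv in Hi as [Hab Hi]. rewrite !NoDup_cons_iff, (IH Hi).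
    enough (In a (map fst u) <-> In b (map snd u)) by tauto.
    rewrite !in_map_iff; split; intros ([a' b'] & E & Hu); simpl in E;
      exists (a', b'); split; auto; apply (Hb a' b' a b); auto.
Qed.

Definition swap {A B : Type} (p : list (A * B)) : list (B * A) :=
  map (fun e => (snd e, fst e)) p.

Lemma in_swap {A B : Type} (p : list (A * B)) a b : In (b, a) (swap p) <-> In (a, b) p.
Proof.
  unfold swap; rewrite in_map_iff; split.
  - intros ([a' b'] & E & H). injection E as -> ->; auto.
  - intros H; exists (a, b); auto.
Qed.

Lemma swap_swap {A B : Type} (p : list (A * B)) : swap (swap p) = p.
Proof. unfold swap; rewrite map_map, <- map_id. apply map_ext; intros []; auto. Qed.

Lemma map_fst_swap {A B : Type} (p : list (A * B)) : map fst (swap p) = map snd p.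
Proof. unfold swap; rewrite map_map; auto. Qed.

Lemma map_snd_swap {A B : Type} (p : list (A * B)) : map snd (swap p) = map fst p.
Proof. unfold swap; rewrite map_map; auto. Qed.

Lemma incl_swap {A B : Type} (p q : list (A * B)) : incl p q -> incl (swap p) (swap q).
Proof. intros H [b a] Hi. apply in_swap, H, in_swap; auto. Qed.

Lemma bij_swap {A B : Type} (p : list (A * B)) : bij p -> bij (swap p).
Proof.
  intros Hb b a b' a' H H'. apply (in_swap p) in H, H'. symmetry; auto.
Qed.

Lemma map_fill_fst {A B : Type} (a : A) (b : B) key :
  map fst (map (fill (a, b)) key) = map (fill a) (map (option_map fst) key).
Proof. rewrite !map_map; apply map_ext; intros [e|]; reflexivity. Qed.

Lemma map_fill_snd {A B : Type} (a : A) (b : B) key :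
  map snd (map (fill (a, b)) key) = map (fill b) (map (option_map snd) key).
Proof. rewrite !map_map; apply map_ext; intros [e|]; reflexivity. Qed.

(** Lets a table keyed by tuples of pairs be projected to one side without two keys colliding. *)
Lemma bij_key_inj {A B : Type} (p : list (A * B)) key key' :
  bij p -> (forall e, In (Some e) key -> In e p) -> (forall e, In (Some e) key' -> In e p) ->
  map (option_map snd) key = map (option_map snd) key' -> key = key'.
Proof.
  intros Hb; revert key'; induction key as [|x key IH]; intros [|x' key'] H H' E;
    try discriminate; auto.
  injection E as E1 E2. f_equal; [|apply IH; simpl in *; auto].
  destruct x as [[a b]|], x' as [[a' b']|]; simpl in *; try discriminate; auto.
  injection E1 as <-. do 2 f_equal. apply (Hb a b a' b); auto.
Qed.

(** The demand [l] is projected to [B], where [bij_key_inj] keeps it functional. As [a] and [b] are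
    both new, the bijection survives. *)
Lemma generic_step {A B T : Type} (col : list B -> T) (p : list (A * B)) a
    (l : list (list (option (A * B)) * T)) :
  generic col -> bij p -> ~ In a (map fst p) ->
  (forall key t e, In (key, t) l -> In (Some e) key -> In e p) ->
  (forall key t t', In (key, t) l -> In (key, t') l -> t = t') ->
  exists b, bij ((a, b) :: p) /\
    forall key t, In (key, t) l -> In None key ->
      col (map snd (map (fill (a, b)) key)) = t.
Proof.
  intros Hg Hb Ha Hp Hf.
  destruct (Hg (map snd p) (map (fun e => (map (option_map snd) (fst e), snd e)) l))
    as (b & Hnb & Hcol).
  - intros key t e Hk He. apply in_map_iff in Hk as ([key' t'] & E & Hk).
    injection E as <- <-. apply in_map_iff in He as ([[a' b']|] & E & Hi); [|discriminate].
    injection E as <-. apply in_map_iff; exists (a', b'); eauto.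
  - intros key t t' Hk Hk'.
    apply in_map_iff in Hk as ([key1 t1] & E & Hk).
    apply in_map_iff in Hk' as ([key2 t2] & E' & Hk').
    simpl in *. injection E as E <-. injection E' as E' <-. subst key.
    apply (bij_key_inj p) in E'; eauto. subst; eauto.
  - exists b; split.
    + intros a1 b1 a2 b2 [E1|H1] [E2|H2];
        try injection E1 as <- <-; try injection E2 as <- <-; auto.
      * tauto.
      * split; intros <-; exfalso; [apply Ha|apply Hnb];
          apply in_map_iff; eexists (_, _); simpl; eauto.
      * split; intros ->; exfalso; [apply Ha|apply Hnb];
          apply in_map_iff; eexists (_, _); simpl; eauto.
    + intros key t Hk Hn. rewrite map_fill_snd. apply Hcol.
      * apply in_map_iff; exists (key, t); auto.
      * apply in_map_iff; exists None; auto.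
Qed.

(** * Extending positions of the game by one element *)

Section Positions.
Variable k : nat.

Section Game.
Context {T1 T2 : chain} {A B : Type} (col1 : list A -> T1) (col2 : list B -> T2).

(** The witness [l] pairs colours, not elements. The pair of origins keeps a colour near the end of
    one chain near the end of the other. As only duplicate-free tuples count, a position with fewer
    than [k] pairs carries no condition on colours. *)
Definition similar (m : Z) (p : list (A * B)) : Prop :=
  bij p /\ exists l, In (org, org) l /\ near_iso m l /\
    forall u, length u = k -> incl u p -> NoDup (map fst u) ->
      In (col1 (map fst u), col2 (map snd u)) l.

Lemma similar_sub m m' p p' : m' <= m -> incl p' p -> similar m p -> similar m' p'.
Proof.
  intros Hm Hi (Hb & l & Ho & Hl & Hu). split; [eapply bij_sub; eauto|].
  exists l; split; [|split]; auto.
  - eapply near_iso_sub; eauto using incl_refl.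
  - intros u Hk Hp; apply Hu; auto. eapply incl_tran; eauto.
Qed.

(** The exponent counts the [k]-words over the old pairs and [None]. Their colours are answered
    first, inside the chain [T2]; genericity of [col2] then gives a single [b] realising all the
    answers. *)
Lemma similar_forth m p a :
  generic col2 -> 0 <= m ->
  similar (2 ^ Z.of_nat (S (length p) ^ k) * m) p -> exists b, similar m ((a, b) :: p).
Proof.
  intros Hg Hm Hs.
  assert (Hle : m <= 2 ^ Z.of_nat (S (length p) ^ k) * m).
  { pose proof (Z.pow_pos_nonneg 2 (Z.of_nat (S (length p) ^ k))). nia. }
  (* An old element is answered by its partner, since genericity only supplies new ones. *)
  destruct (classic (In a (map fst p))) as [Ha|Ha].
  { apply in_map_iff in Ha as ([a' b] & E & Hi). simpl in E; subst a'. exists b.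
    eapply similar_sub; [exact Hle| |exact Hs]. apply incl_cons; auto using incl_refl. }
  destruct Hs as (Hb & l & Ho & Hl & Hu).
  set (q := None :: map Some p).
  set (f := fun key : list (option (A * B)) => col1 (map (fill a) (map (option_map fst) key))).
  destruct (near_iso_extend_list f (words k q) m l) as (l' & E & Hl'); auto.
  { rewrite length_words; unfold q; simpl length; rewrite length_map; exact Hl. }
  assert (Hkeys : forall key t, In (key, t) l' -> incl key q).
  { intros key t Hk. apply (in_words k). rewrite <- E.
    apply in_map_iff; exists (key, t); auto. }
  destruct (generic_step col2 p a l') as (b & Hbij & Hcol); auto.
  - intros key t e Hk He. apply (Hkeys _ _ Hk) in He as [He|He]; [discriminate|].
    apply in_map_iff in He as (e' & He & Hi). congruence.
  (* Two answers to the same [f key] are at offset 0 from each other, hence equal. *)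
  - intros key t t' H H'. apply off_eq. apply (Hl' (f key) t (f key) t' 0); [| |lia|].
    + apply in_or_app; left; apply in_map_iff; exists (key, t); auto.
    + apply in_or_app; left; apply in_map_iff; exists (key, t'); auto.
    + apply off_refl; auto.
  - exists b; split; auto.
    exists (map (fun e => (f (fst e), snd e)) l' ++ l); split; [|split]; auto.
    + apply in_or_app; auto.
    + intros u Hk Hi Hn. destruct (words_key _ _ _ Hi) as (key & Hkey & -> & Hnone).
      apply in_or_app. destruct (classic (In None key)) as [HN|HN]; [left|right; auto].
      assert (Hw : In key (words k q)).
      { apply in_words; split; auto. rewrite length_map in Hk; auto. }
      rewrite <- E in Hw. apply in_map_iff in Hw as ([key' t] & E' & Hw).
      simpl in E'; subst key'. apply in_map_iff; exists (key, t); split; auto.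
      rewrite (Hcol _ _ Hw HN). simpl. unfold f. rewrite map_fill_fst. reflexivity.
Qed.

End Game.

Lemma similar_swap {T1 T2 : chain} {A B : Type} (col1 : list A -> T1) (col2 : list B -> T2) m p :
  similar col1 col2 m p -> similar col2 col1 m (swap p).
Proof.
  intros (Hb & l & Ho & Hl & Hu). split; [apply bij_swap; auto|].
  exists (swap l); split; [|split].
  - apply in_swap; auto.
  - intros b a b' a' z H H' Hz. apply (in_swap l) in H, H'. symmetry; auto.
  - intros u Hk Hi Hn. apply incl_swap in Hi. rewrite swap_swap in Hi.
    rewrite <- (map_snd_swap u), <- (map_fst_swap u). apply (in_swap l), Hu; auto.
    + unfold swap; rewrite length_map; auto.
    + rewrite (bij_NoDup p), map_snd_swap; auto.
Qed.

Lemma similar_back {T1 T2 : chain} {A B : Type} (col1 : list A -> T1) (col2 : list B -> T2) m p b :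
  generic col1 -> 0 <= m ->
  similar col1 col2 (2 ^ Z.of_nat (S (length p) ^ k) * m) p ->
  exists a, similar col1 col2 m ((a, b) :: p).
Proof.
  intros Hg Hm H. apply similar_swap in H.
  destruct (similar_forth col2 col1 m (swap p) b) as [a Ha]; auto.
  { unfold swap at 1; rewrite length_map; exact H. }
  exists a. apply similar_swap in Ha. simpl in Ha. rewrite swap_swap in Ha; auto.
Qed.

(** The exact counterpart of [similar], for colours in the same type: extending it costs no
    precision, so no rounds have to be counted. *)
Definition col_iso {A B T : Type} (col1 : list A -> T) (col2 : list B -> T)
    (p : list (A * B)) : Prop :=
  bij p /\ forall u, length u = k -> incl u p -> NoDup (map fst u) ->
    col1 (map fst u) = col2 (map snd u).

Lemma col_iso_swap {A B T : Type} (col1 : list A -> T) (col2 : list B -> T) p :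
  col_iso col1 col2 p -> col_iso col2 col1 (swap p).
Proof.
  intros (Hb & Hu). split; [apply bij_swap; auto|].
  intros u Hk Hi Hn. apply incl_swap in Hi. rewrite swap_swap in Hi.
  rewrite <- (map_snd_swap u), <- (map_fst_swap u). symmetry; apply Hu; auto.
  - unfold swap; rewrite length_map; auto.
  - rewrite (bij_NoDup p), map_snd_swap; auto.
Qed.

Lemma col_iso_forth {A B T : Type} (col1 : list A -> T) (col2 : list B -> T) p a :
  generic col2 -> col_iso col1 col2 p -> exists b, col_iso col1 col2 ((a, b) :: p).
Proof.
  intros Hg (Hb & Hu).
  destruct (classic (In a (map fst p))) as [Ha|Ha].
  { apply in_map_iff in Ha as ([a' b] & E & Hi). simpl in E; subst a'. exists b.
    assert (Hi' : incl ((a, b) :: p) p) by (apply incl_cons; auto using incl_refl).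
    split; [eapply bij_sub; eauto|]. intros u ? ?; apply Hu; auto. eapply incl_tran; eauto. }
  set (q := None :: map Some p).
  set (f := fun key : list (option (A * B)) => col1 (map (fill a) (map (option_map fst) key))).
  destruct (generic_step col2 p a (map (fun key => (key, f key)) (words k q)))
    as (b & Hbij & Hcol); auto.
  - intros key t e Hk He. apply in_map_iff in Hk as (key' & E & Hk). injection E as -> <-.
    apply in_words in Hk as [_ Hk]. apply Hk in He as [He|He]; [discriminate|].
    apply in_map_iff in He as (e' & He & Hi). congruence.
  - intros key t t' H H'. apply in_map_iff in H as (? & E & _), H' as (? & E' & _). congruence.
  - exists b; split; auto. intros u Hk Hi Hn.
    destruct (words_key _ _ _ Hi) as (key & Hkey & -> & Hnone).
    destruct (classic (In None key)) as [HN|HN]; [|auto].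
    rewrite (Hcol key (f key)); auto.
    + unfold f; rewrite map_fill_fst; auto.
    + apply in_map_iff; exists key; split; auto. apply in_words; split; auto.
      rewrite length_map in Hk; auto.
Qed.

Lemma col_iso_forth_list {A B T : Type} (col1 : list A -> T) (col2 : list B -> T) p l :
  generic col2 -> col_iso col1 col2 p ->
  exists p', col_iso col1 col2 p' /\ incl p p' /\ incl l (map fst p').
Proof.
  intros Hg Hp; induction l as [|a l (p' & Hp' & Hi & Hl)].
  - exists p; auto using incl_refl, incl_nil_l.
  - destruct (col_iso_forth col1 col2 p' a Hg Hp') as [b Hb].
    exists ((a, b) :: p'); split; [exact Hb|split].
    + apply incl_tl; auto.
    + simpl; apply incl_cons; simpl; auto. apply incl_tl; auto.
Qed.

End Positions.

(** * The edge models and what atoms see of assignments *)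

Section Structures.
Variable k : nat.

Definition edge_sig : signature :=
  {| rsym := unit; rar := fun _ => (2 * k)%nat;
     fsym := Empty_set; far := fun _ => 0%nat |}.

Definition edge {D : Type} {T : chain} (col : list D -> T) (l : list D) : Prop :=
  length l = (2 * k)%nat /\ NoDup (firstn k l) /\ NoDup (skipn k l) /\
  off (col (firstn k l)) (col (skipn k l)) (-1).

Definition edge_model (T : chain) : model edge_sig.
Proof.
  refine (@Build_model edge_sig (tree T) (fun _ l => edge (colour T org) l)
            (fun f : Empty_set => match f with end) _).
  exists (Node T []), (Node T [([], org)]); discriminate.
Defined.

Section Related.
Context {A B : Type}.

Definition related (p : list (A * B)) (s : nat -> option A) (t : nat -> option B) : Prop :=
  forall x, match s x, t x with
            | Some a, Some b => In (a, b) p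
            | None, None => True
            | _, _ => False
            end.

Definition upd {A : Type} (s : nat -> option A) (x : nat) (a : A) : nat -> option A :=
  fun y => if Nat.eqb y x then Some a else s y.

Lemma related_upd p s t x a b :
  related p s t -> related ((a, b) :: p) (upd s x a) (upd t x b).
Proof.
  intros H y; unfold upd. destruct (Nat.eqb y x); simpl; auto.
  specialize (H y). destruct (s y), (t y); auto.
Qed.

(** What atoms can observe of an assignment: its domain, the equalities among its values, and the
    relation on tuples of values. *)
Definition agree (RA : list A -> Prop) (RB : list B -> Prop)
    (s : nat -> option A) (t : nat -> option B) : Prop :=
  (forall x, s x = None <-> t x = None) /\
  (forall x y, s x = s y <-> t x = t y) /\
  (forall xs l, map s xs = map Some l ->
     exists l', map t xs = map Some l' /\ (RA l <-> RB l')).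

Lemma related_lists p s t xs l :
  related p s t -> map s xs = map Some l ->
  exists u, incl u p /\ map fst u = l /\ map t xs = map Some (map snd u).
Proof.
  intros H; revert l; induction xs as [|x xs IH]; intros [|a l] E; try discriminate.
  - exists []; auto using incl_nil_l.
  - injection E as E1 E2. destruct (IH _ E2) as (u & Hu & <- & Et).
    specialize (H x). rewrite E1 in H. destruct (t x) as [b|] eqn:Eb; [|contradiction].
    exists ((a, b) :: u); simpl; repeat split; [|congruence].
    apply incl_cons; auto.
Qed.

Lemma related_agree RA RB p s t :
  bij p -> (forall u, incl u p -> (RA (map fst u) <-> RB (map snd u))) ->
  related p s t -> agree RA RB s t.
Proof.
  intros Hb HR H; split; [|split].
  - intros x; specialize (H x). destruct (s x), (t x); split; intros; try discriminate; tauto.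
  - intros x y; pose proof (H x) as Hx; pose proof (H y) as Hy.
    destruct (s x), (t x), (s y), (t y); try contradiction;
      try (split; intros; discriminate); try tauto.
    pose proof (Hb _ _ _ _ Hx Hy). split; intros E; injection E as E; f_equal; tauto.
  - intros xs l E. destruct (related_lists _ _ _ _ _ H E) as (u & Hu & <- & Et).
    eauto.
Qed.

End Related.

Lemma agree_trans {A B C : Type} (RA : list A -> Prop) (RB : list B -> Prop)
    (RC : list C -> Prop) s t w :
  agree RA RB s t -> agree RB RC t w -> agree RA RC s w.
Proof.
  intros (H1 & H2 & H3) (H4 & H5 & H6). split; [|split].
  - intros x; rewrite H1; auto.
  - intros x y; rewrite H2; auto.
  - intros xs l E. destruct (H3 _ _ E) as (l' & E' & Hl).
    destruct (H6 _ _ E') as (l'' & E'' & Hl'). exists l''; split; auto. tauto.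
Qed.

(** An edge is an offset of -1 between colours, so precision 1 is enough to preserve it. *)
Lemma similar_edge {T1 T2 : chain} {A B : Type} (col1 : list A -> T1) (col2 : list B -> T2) m p u :
  1 <= m -> similar k col1 col2 m p -> incl u p ->
  (edge col1 (map fst u) <-> edge col2 (map snd u)).
Proof.
  intros Hm (Hb & l & Ho & Hl & Hu) Hi. unfold edge.
  rewrite !firstn_map, !skipn_map, !length_map.
  pose proof Hi as H12. rewrite <- (firstn_skipn k u) in H12.
  apply incl_app_inv in H12 as [I1 I2].
  rewrite <- (bij_NoDup _ _ Hb I1), <- (bij_NoDup _ _ Hb I2).
  split; intros (Hlen & N1 & N2 & H); repeat split; auto; revert H;
    apply Hl; try lia; apply Hu; auto; rewrite ?length_firstn, ?length_skipn; lia.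
Qed.

Lemma col_iso_edge {T : chain} {A B : Type} (col1 : list A -> T) (col2 : list B -> T) p u :
  col_iso k col1 col2 p -> incl u p -> (edge col1 (map fst u) <-> edge col2 (map snd u)).
Proof.
  intros (Hb & Hu) Hi. unfold edge.
  rewrite !firstn_map, !skipn_map, !length_map.
  pose proof Hi as H12. rewrite <- (firstn_skipn k u) in H12.
  apply incl_app_inv in H12 as [I1 I2].
  rewrite <- (bij_NoDup _ _ Hb I1), <- (bij_NoDup _ _ Hb I2).
  split; intros (Hlen & N1 & N2 & H); repeat split; auto; revert H;
    rewrite !Hu; auto; rewrite ?length_firstn, ?length_skipn; lia.
Qed.

Lemma col_iso_comp {T : Type} {A B C : Type} (col1 : list A -> T) (col2 : list B -> T)
    (col3 : list C -> T) p q s t w :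
  col_iso k col1 col2 p -> col_iso k col2 col3 q -> related p s t -> related q t w ->
  exists r, col_iso k col1 col3 r /\ related r s w.
Proof.
  intros (Hp & Cp) (Hq & Cq) Hs Ht.
  (* The relational composite of [p] and [q] as a list, with middle elements compared
     classically. *)
  set (r := flat_map (fun e => flat_map (fun f =>
         if excluded_middle_informative (snd e = fst f) then [(fst e, snd f)] else []) q) p).
  assert (Hr : forall a c, In (a, c) r <-> exists b, In (a, b) p /\ In (b, c) q).
  { intros a c; unfold r; rewrite in_flat_map. split.
    - intros ([a' b] & H1 & H2). apply in_flat_map in H2 as ([b' c'] & H2 & H3). simpl in H3.
      destruct (excluded_middle_informative (b = b')) as [->|]; [|contradiction].
      destruct H3 as [E|[]]; injection E as -> ->; eauto.
    - intros (b & H1 & H2). exists (a, b); split; auto. apply in_flat_map.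
      exists (b, c); split; auto. simpl.
      destruct (excluded_middle_informative (b = b)); [left; auto|tauto]. }
  assert (Hu : forall u, incl u r -> exists v, incl v p /\ exists v', incl v' q /\
            map fst v = map fst u /\ map snd v = map fst v' /\ map snd v' = map snd u).
  { induction u as [|[a c] u IH]; intros Hi.
    - exists []; split; [apply incl_nil_l|]. exists []; auto using incl_nil_l.
    - apply incl_cons_inv in Hi as [Hac Hi]. apply Hr in Hac as (b & Hab & Hbc).
      destruct (IH Hi) as (v & Hv & v' & Hv' & E1 & E2 & E3).
      exists ((a, b) :: v); split; [apply incl_cons; auto|].
      exists ((b, c) :: v'); split; [apply incl_cons; auto|].
      simpl; repeat split; congruence. }
  exists r; split; [split|].
  - intros a c a' c' H H'. apply Hr in H as (b & H1 & H2), H' as (b' & H1' & H2').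
    rewrite (Hp _ _ _ _ H1 H1'). eapply Hq; eauto.
  - intros u Hk Hi Hn. destruct (Hu u Hi) as (v & Hv & v' & Hv' & E1 & E2 & E3).
    assert (L1 : length v = length u) by (rewrite <- (length_map fst v), E1, length_map; auto).
    assert (L2 : length v' = length u) by (rewrite <- (length_map snd v'), E3, length_map; auto).
    rewrite <- E1, <- E3. rewrite <- E1 in Hn. rewrite Cp, E2, Cq; auto; try lia.
    rewrite <- E2. apply (bij_NoDup p); auto.
  - intros x; specialize (Hs x); specialize (Ht x).
    destruct (s x), (t x), (w x); try contradiction; auto. apply Hr; eauto.
Qed.

(** * Game equivalence of assignments over two models *)

Section Transfer.
Variables T1 T2 : chain.
Variable n : nat.

Let A := edge_model T1.
Let B := edge_model T2.
Let col1 : list (carrier A) -> T1 := colour T1 org.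
Let col2 : list (carrier B) -> T2 := colour T2 org.

(* A move from a position of size [< n] creates at most [n ^ k] colours, and answering each of them
   halves the distance up to which the colours are matched. *)
Definition threshold (r : nat) : Z := 2 ^ (Z.of_nat r * Z.of_nat (n ^ k)).

Lemma threshold_pos r : 1 <= threshold r.
Proof. unfold threshold. pose proof (Z.pow_pos_nonneg 2 (Z.of_nat r * Z.of_nat (n ^ k))). nia. Qed.

(** Every move adds a pair, even when it overwrites a variable. The equation caps the position at
    [n] pairs, so one exponent [n ^ k] serves for all moves. *)
Definition game (r : nat) (s : assignment A) (t : assignment B) : Prop :=
  exists p, (length p + r = n)%nat /\ similar k col1 col2 (threshold r) p /\ related p s t.

Definition iso (t t' : assignment B) : Prop :=
  exists p, col_iso k col2 col2 p /\ related p t t'.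

(** The isomorphism is kept apart from the game position: its list may have any length without using
    up rounds, and the relation becomes stable under [iso] in [t]. *)
Definition equiv (r : nat) (s : assignment A) (t : assignment B) : Prop :=
  exists t0, game r s t0 /\ iso t0 t.

Lemma iso_trans t1 t2 t3 : iso t1 t2 -> iso t2 t3 -> iso t1 t3.
Proof.
  intros (p & Hp & H12) (q & Hq & H23).
  destruct (col_iso_comp _ _ _ _ _ _ _ _ Hp Hq H12 H23) as (r & Hr & H13). exists r; auto.
Qed.

Lemma equiv_iso r s t t' : equiv r s t -> iso t t' -> equiv r s t'.
Proof. intros (t0 & Hg & Hi) H. exists t0; split; auto. eapply iso_trans; eauto. Qed.

Lemma iso_sym t t' : iso t t' -> iso t' t.
Proof.
  intros (p & Hp & H). exists (swap p); split.
  - apply col_iso_swap; auto.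
  - intros x; specialize (H x). destruct (t x) as [b|], (t' x) as [b'|]; auto.
    apply in_swap; auto.
Qed.

Lemma iso_forth t t' x b : iso t t' -> exists b', iso (update t x b) (update t' x b').
Proof.
  intros (p & Hp & H).
  destruct (col_iso_forth k col2 col2 p b (colour_generic _ _) Hp) as [b' Hb'].
  exists b', ((b, b') :: p); split; auto. apply related_upd; auto.
Qed.

Lemma threshold_succ {P : Type} r (p : list P) : (length p + S r = n)%nat ->
  2 ^ Z.of_nat (S (length p) ^ k) * threshold r <= threshold (S r).
Proof.
  intros H. unfold threshold. rewrite <- Z.pow_add_r by lia.
  apply Z.pow_le_mono_r; [lia|].
  assert (S (length p) ^ k <= n ^ k)%nat by (apply Nat.pow_le_mono_l; lia). nia.
Qed.

Lemma equiv_forth r s t x a :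
  equiv (S r) s t -> exists b, equiv r (update s x a) (update t x b).
Proof.
  intros (t0 & (p & Hn & Hp & H) & Hi).
  pose proof (threshold_pos r).
  destruct (similar_forth k col1 col2 (threshold r) p a) as [b0 Hb0].
  { apply colour_generic. }
  { lia. }
  { eapply similar_sub; [apply threshold_succ; eauto|apply incl_refl|exact Hp]. }
  destruct (iso_forth _ _ x b0 Hi) as [b Hb].
  exists b, (update t0 x b0); split; auto.
  exists ((a, b0) :: p); split; [rewrite Nat.add_succ_r in Hn; exact Hn|split; [exact Hb0|]].
  apply related_upd; auto.
Qed.

Lemma equiv_back r s t x b :
  equiv (S r) s t -> exists a, equiv r (update s x a) (update t x b).
Proof.
  intros (t0 & (p & Hn & Hp & H) & Hi).
  pose proof (threshold_pos r).
  destruct (iso_forth _ _ x b (iso_sym _ _ Hi)) as [b0 Hb].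
  destruct (similar_back k col1 col2 (threshold r) p b0) as [a Ha].
  { apply colour_generic. }
  { lia. }
  { eapply similar_sub; [apply threshold_succ; eauto|apply incl_refl|exact Hp]. }
  exists a, (update t0 x b0); split; [|apply iso_sym; auto].
  exists ((a, b0) :: p); split; [rewrite Nat.add_succ_r in Hn; exact Hn|split; [exact Ha|]].
  apply related_upd; auto.
Qed.

Lemma equiv_agree r s t : equiv r s t -> agree (edge col1) (edge col2) s t.
Proof.
  intros (t0 & (p & Hn & Hp & H) & (q & Hq & H')).
  eapply agree_trans; eapply related_agree; eauto.
  - apply Hp.
  - intros u Hu; eapply similar_edge; eauto. apply threshold_pos.
  - apply Hq.
  - intros u Hu; eapply col_iso_edge; eauto.
Qed.

(* [t] need not be [None] at [x], so the old value at [x] has to be moved along as well. *)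
Lemma iso_update_inv t x b t1 :
  iso (update t x b) t1 -> exists t2 b1, t1 = update t2 x b1 /\ iso t t2.
Proof.
  intros (p & Hp & H).
  assert (Hx := H x). unfold update in Hx at 1. rewrite Nat.eqb_refl in Hx.
  destruct (t1 x) as [b1|] eqn:E1; [|contradiction].
  assert (Hc : exists o p', col_iso k col2 col2 p' /\ incl p p' /\
            match t x, o with Some c, Some d => In (c, d) p' | None, None => True
                            | _, _ => False end).
  { destruct (t x) as [c|].
    - destruct (col_iso_forth k col2 col2 p c (colour_generic _ _) Hp) as [d Hd].
      exists (Some d), ((c, d) :: p); simpl; auto using incl_tl, incl_refl.
    - exists None, p; auto using incl_refl. }
  destruct Hc as (o & p' & Hp' & Hi & Ho).
  exists (fun y => if Nat.eqb y x then o else t1 y), b1; split.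
  - apply functional_extensionality; intros y. unfold update.
    destruct (Nat.eqb y x) eqn:E; auto. apply Nat.eqb_eq in E; subst; auto.
  - exists p'; split; auto. intros y. specialize (H y). unfold update in H.
    destruct (Nat.eqb y x) eqn:E.
    + apply Nat.eqb_eq in E; subst; auto.
    + destruct (t y), (t1 y); auto.
Qed.

Lemma map_eq_combine {C : Type} (f g : nat -> C) xs ys :
  length xs = length ys ->
  (map f xs = map g ys <-> forall x y, In (x, y) (combine xs ys) -> f x = g y).
Proof.
  revert ys; induction xs as [|x xs IH]; intros [|y ys] H; try discriminate; simpl.
  - split; [intros _ ? ? []|auto].
  - injection H as H. specialize (IH _ H). split.
    + intros E x' y' [E'|Hi]; injection E as E1 E2; [congruence|]. apply IH; auto.
    + intros E; f_equal; [apply E; auto|]. apply IH; auto.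
Qed.

(* A tuple of length [< k] carries no structure besides equalities, so two such tuples with the
   same equalities are conjugate. *)
Lemma iso_transitive (t t'' : assignment B) xs ys (l : list (carrier B)) :
  (length xs < k)%nat -> length xs = length ys ->
  (forall x b, t'' x = Some b -> In b l) ->
  (forall x y, In (x, y) (combine xs ys) -> (t x = None <-> t'' y = None)) ->
  (forall x y x' y', In (x, y) (combine xs ys) -> In (x', y') (combine xs ys) ->
     (t x = t x' <-> t'' y = t'' y')) ->
  exists t', iso t'' t' /\ map t xs = map t' ys.
Proof.
  intros Hk Hlen Hl HN HE.
  (* Sends the value of [t''] at each [y] to the value of [t] at the paired [x]; the rest of the
     range of [t''], listed in [l], is added afterwards. *)
  set (p0 := flat_map (fun e => match t'' (snd e), t (fst e) with
                                | Some b, Some c => [(b, c)] | _, _ => [] end) (combine xs ys)).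
  assert (Hp0 : forall b c, In (b, c) p0 <-> exists x y, In (x, y) (combine xs ys) /\
                  t'' y = Some b /\ t x = Some c).
  { intros b c; unfold p0; rewrite in_flat_map; split.
    - intros ([x y] & Hi & H). exists x, y. simpl in H.
      destruct (t'' y), (t x); try contradiction. destruct H as [E|[]].
      injection E as -> ->; auto.
    - intros (x & y & Hi & E1 & E2). exists (x, y); split; auto. simpl.
      rewrite E1, E2; simpl; auto. }
  assert (Hlp : (length p0 < k)%nat).
  { apply Nat.le_lt_trans with (length (combine xs ys));
      [|rewrite length_combine, <- Hlen, Nat.min_id; auto].
    unfold p0; clear. induction (combine xs ys) as [|[x y] zs IH]; simpl; auto.
    rewrite length_app. destruct (t'' y), (t x); simpl; auto using le_n_S. }
  assert (Hiso : col_iso k col2 col2 p0).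
  { split.
    - intros b c b' c' H H'. apply Hp0 in H as (x & y & Hi & E1 & E2).
      apply Hp0 in H' as (x' & y' & Hi' & E1' & E2').
      specialize (HE _ _ _ _ Hi Hi'). rewrite E1, E1', E2, E2' in HE.
      split; intros ->; [apply proj2 in HE|apply proj1 in HE];
        specialize (HE eq_refl); congruence.
    (* Such a [u] would consist of [k] distinct pairs, but [p0] has fewer. *)
    - intros u Hu Hi Hn. apply NoDup_map_inv in Hn.
      exfalso; apply (Nat.lt_irrefl k). rewrite <- Hu at 1.
      exact (Nat.le_lt_trans _ _ _ (NoDup_incl_length Hn Hi) Hlp). }
  destruct (col_iso_forth_list k col2 col2 p0 l (colour_generic _ _) Hiso)
    as (p & Hp & Hi & Hc).
  assert (Himg : forall x, exists o, match t'' x, o with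
                  | Some b, Some c => In (b, c) p | None, None => True | _, _ => False end).
  { intros x. destruct (t'' x) as [b|] eqn:E; [|exists None; auto].
    apply Hl, Hc, in_map_iff in E as ([b' c] & <- & H). exists (Some c); auto. }
  set (t' := fun x => proj1_sig (constructive_indefinite_description _ (Himg x))).
  assert (Ht' : related p t'' t').
  { intros x; unfold t'. destruct (constructive_indefinite_description _ _); auto. }
  exists t'; split; [exists p; auto|].
  apply map_eq_combine; auto. intros x y Hxy.
  specialize (Ht' y). specialize (HN _ _ Hxy).
  destruct (t'' y) as [b|] eqn:Eb.
  - destruct (t' y) as [c'|]; [|contradiction].
    destruct (t x) as [c|] eqn:Ec; [|destruct HN as [HN _]; discriminate HN; auto].
    f_equal. assert (H : In (b, c) p) by (apply Hi, Hp0; eauto).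
    apply (proj1 Hp _ _ _ _ H Ht'); auto.
  - destruct (t' y); [contradiction|]. apply HN; auto.
Qed.

Lemma equiv_range r s t : equiv r s t -> exists l, forall x b, t x = Some b -> In b l.
Proof.
  intros (t0 & _ & (p & _ & H)). exists (map snd p). intros x b E.
  specialize (H x). rewrite E in H. destruct (t0 x) as [b0|]; [|contradiction].
  apply in_map_iff; exists (b0, b); auto.
Qed.

(** * Transfer of satisfaction from team to team *)

Fixpoint qr (phi : formula edge_sig) : nat :=
  match phi with
  | FAnd p q | FOr p q => Nat.max (qr p) (qr q)
  | FAll _ p | FEx _ p => S (qr p)
  | _ => 0
  end.

Lemma term_var (t : term edge_sig) : exists x, t = TVar x.
Proof. destruct t as [x|[]]; eauto. Qed.

Lemma terms_vars (ts : list (term edge_sig)) : exists xs, ts = map TVar xs.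
Proof.
  induction ts as [|t ts [xs ->]]; [exists []; auto|].
  destruct (term_var t) as [x ->]. exists (x :: xs); auto.
Qed.

Lemma evals_vars (M : model edge_sig) (s : assignment M) xs l :
  evals s (map TVar xs) = Some l <-> map s xs = map Some l.
Proof.
  revert l; induction xs as [|x xs IH]; intros [|b l]; simpl; try (split; discriminate).
  - split; reflexivity.
  - destruct (s x); [|split; discriminate].
    destruct (evals s (map TVar xs)); split; discriminate.
  - specialize (IH l). destruct (s x) as [a|]; [|split; discriminate].
    destruct (evals s (map TVar xs)) as [r|]; split; intros E; try discriminate.
    + injection E as -> ->. f_equal. apply IH; reflexivity.
    + injection E as -> E. apply IH in E. injection E as ->. reflexivity.
    + injection E as _ E. apply IH in E. discriminate.
Qed.

(** Closure under [iso] is asked of [Y] alone: satisfaction passes only from [X] to [Y], so only [Y]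
    has to supply witnesses for inclusion atoms. *)
Definition team_sim (r : nat) (X : team A) (Y : team B) : Prop :=
  (forall t, Y t -> exists s, X s /\ equiv r s t) /\
  (forall s, X s -> exists t, Y t /\ equiv r s t) /\
  (forall t t', Y t -> iso t t' -> Y t').

(** Each half of a split of [X] receives all its matches in [Y]. The halves of [Y] may overlap, as
    lax disjunction allows. *)
Lemma team_sim_split r X Y X1 :
  team_sim r X Y -> (forall s, X1 s -> X s) ->
  team_sim r X1 (fun t => Y t /\ exists s, X1 s /\ equiv r s t).
Proof.
  intros (H1 & H2 & H3) Hi. split; [|split].
  - intros t [_ Ht]; auto.
  - intros s Hs. destruct (H2 s (Hi s Hs)) as (t & Ht & He). exists t; eauto.
  - intros t t' [Ht (s & Hs & He)] Hiso. split; [eauto|]. exists s; eauto using equiv_iso.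
Qed.

Lemma sat_transfer (phi : formula edge_sig) :
  (1 <= k)%nat -> inc_bound (k - 1) phi ->
  forall r X Y, (qr phi <= r)%nat -> team_sim r X Y -> sat X phi -> sat Y phi.
Proof.
  intros Hk1; induction phi as [xs ys|t1 t2|t1 t2|R ts|R ts|p IHp q IHq|p IHp q IHq|x p IHp|x p IHp];
    simpl; intros Hinc r X Y Hr Hsim Hsat; pose proof Hsim as (H1 & H2 & H3).
  - intros t Ht. destruct (H1 t Ht) as (s & Hs & He).
    destruct (Hsat s Hs) as (s' & Hs' & Em).
    destruct (H2 s' Hs') as (t'' & Ht'' & He').
    destruct (equiv_range _ _ _ He') as [l Hl].
    assert (Hlen : length xs = length ys).
    { pose proof (f_equal (@length _) Em) as El. rewrite !length_map in El; exact El. }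
    pose proof (proj1 (map_eq_combine s s' xs ys Hlen) Em) as Ec.
    apply equiv_agree in He as (N1 & E1 & _). apply equiv_agree in He' as (N2 & E2 & _).
    (* Moves the match [t''] of the witness [s'] to a [t'] whose values on [ys] are those of [t] on
       [xs]; closure under [iso] keeps [t'] in [Y]. *)
    destruct (iso_transitive t t'' xs ys l) as (t' & Hiso & E); auto.
    + lia.
    + intros x y Hxy. rewrite <- N1, <- N2, (Ec _ _ Hxy). tauto.
    + intros x y x' y' Hxy Hxy'.
      rewrite <- E1, <- E2, (Ec _ _ Hxy), (Ec _ _ Hxy'). tauto.
    + exists t'; split; eauto.
  - intros t Ht. destruct (H1 t Ht) as (s & Hs & He).
    destruct (Hsat s Hs) as (a & E1 & E2).
    destruct (term_var t1) as [x ->], (term_var t2) as [y ->]; simpl in *.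
    apply equiv_agree in He as (N & E & _).
    destruct (t x) as [b|] eqn:Eb; [|apply N in Eb; congruence].
    exists b; split; auto. transitivity (t x); [symmetry|exact Eb].
    apply E. transitivity (Some a); auto.
  - intros t Ht. destruct (H1 t Ht) as (s & Hs & He).
    destruct (Hsat s Hs) as (a & b & E1 & E2 & Hab).
    destruct (term_var t1) as [x ->], (term_var t2) as [y ->]; simpl in *.
    apply equiv_agree in He as (N & E & _).
    destruct (t x) as [a'|] eqn:Ea; [|apply N in Ea; congruence].
    destruct (t y) as [b'|] eqn:Eb; [|apply N in Eb; congruence].
    exists a', b'; repeat split; auto. intros ->.
    apply Hab. assert (s x = s y) by (apply E; congruence). congruence.
  - intros t Ht. destruct (H1 t Ht) as (s & Hs & He).
    destruct (Hsat s Hs) as (l & E & HR).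
    destruct (terms_vars ts) as [xs ->]. apply (proj1 (evals_vars A s xs l)) in E.
    apply equiv_agree in He as (_ & _ & HL).
    destruct (HL _ _ E) as (l' & E' & Hl). exists l'; split; [apply (proj2 (evals_vars B t xs l')); auto|].
    apply Hl; exact HR.
  - intros t Ht. destruct (H1 t Ht) as (s & Hs & He).
    destruct (Hsat s Hs) as (l & E & HR).
    destruct (terms_vars ts) as [xs ->]. apply (proj1 (evals_vars A s xs l)) in E.
    apply equiv_agree in He as (_ & _ & HL).
    destruct (HL _ _ E) as (l' & E' & Hl). exists l'; split; [apply (proj2 (evals_vars B t xs l')); auto|].
    intros G; apply HR, Hl; exact G.
  - destruct Hinc as [Ip Iq], Hsat as [Sp Sq].
    split; [apply (IHp Ip r X)|apply (IHq Iq r X)]; auto; lia.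
  - destruct Hinc as [Ip Iq], Hsat as (X1 & X2 & HX & S1 & S2).
    exists (fun t => Y t /\ exists s, X1 s /\ equiv r s t),
           (fun t => Y t /\ exists s, X2 s /\ equiv r s t).
    split; [|split].
    + intros t; split; [|tauto]. intros Ht. destruct (H1 t Ht) as (s & Hs & He).
      apply HX in Hs as [Hs|Hs]; eauto 6.
    + apply (IHp Ip r X1); [lia| |exact S1].
      apply (team_sim_split r X); [exact Hsim|intros; apply HX; auto].
    + apply (IHq Iq r X2); [lia| |exact S2].
      apply (team_sim_split r X); [exact Hsim|intros; apply HX; auto].
  - destruct r as [|r]; [lia|]. eapply (IHp Hinc r); [lia| |exact Hsat].
    split; [|split].
    + intros t (t0 & b & Ht0 & ->). destruct (H1 _ Ht0) as (s & Hs & He).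
      destruct (equiv_back _ _ _ x b He) as [a Ha]. eauto 6.
    + intros s (s0 & a & Hs0 & ->). destruct (H2 _ Hs0) as (t & Ht & He).
      destruct (equiv_forth _ _ _ x a He) as [b Hb]. eauto 6.
    + intros t t1 (t0 & b & Ht0 & ->) Hi.
      apply iso_update_inv in Hi as (t2 & b1 & -> & Hi). eauto.
  - destruct r as [|r]; [lia|]. destruct Hsat as (F & HF & Hsat).
    (* Lax choice: every [b] that answers some allowed [a] is taken, so that the new team is again
       closed under [iso]. *)
    exists (fun t b => exists s a, X s /\ F s a /\ equiv r (update s x a) (update t x b)).
    split.
    + intros t Ht. destruct (H1 _ Ht) as (s & Hs & He). destruct (HF s Hs) as [a Ha].
      destruct (equiv_forth _ _ _ x a He) as [b Hb]. eauto 6.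
    + eapply (IHp Hinc r); [lia| |exact Hsat]. split; [|split].
      * intros t (t0 & b & Ht0 & (s & a & Hs & Ha & He) & ->). eauto 8.
      * intros s (s0 & a & Hs0 & Ha & ->). destruct (H2 _ Hs0) as (t & Ht & He).
        destruct (equiv_forth _ _ _ x a He) as [b Hb]. exists (update t x b).
        split; auto. exists t, b; split; [auto|split; auto]. eauto 6.
      * intros t t1 (t0 & b & Ht0 & (s & a & Hs & Ha & He) & ->) Hi.
        pose proof (equiv_iso _ _ _ _ He Hi) as He1.
        apply iso_update_inv in Hi as (t2 & b1 & -> & Hi).
        exists t2, b1; split; [eauto|split; auto]. eauto 6.
Qed.

Lemma empty_equiv : (1 <= k)%nat -> equiv n (empty_asg A) (empty_asg B).
Proof.
  intros Hk.
  assert (Hu : forall (D : Type) (u : list D), length u = k -> incl u [] -> False).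
  { intros D u Hu Hi. apply incl_l_nil in Hi. subst u. simpl in Hu. lia. }
  exists (empty_asg B); split; exists [].
  - split; [auto|split; [split|]].
    + intros ? ? ? ? [].
    + exists [(org, org)]; split; [left; auto|split].
      * intros a a' b b' z [E|[]] [E'|[]] _. injection E as <- <-. injection E' as <- <-.
        rewrite !off_refl; tauto.
      * intros u Hk' Hi. destruct (Hu _ u Hk' Hi).
    + intros x; exact I.
  - split; [split|].
    + intros ? ? ? ? [].
    + intros u Hk' Hi. destruct (Hu _ u Hk' Hi).
    + intros x; exact I.
Qed.

End Transfer.

Lemma true_in_transfer (T1 T2 : chain) (psi : formula edge_sig) :
  (1 <= k)%nat -> inc_bound (k - 1) psi ->
  true_in (edge_model T1) psi -> true_in (edge_model T2) psi.
Proof.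
  (* The game has as many rounds as the quantifier rank, all still to be played at the empty
     position. *)
  intros Hk Hinc. apply (sat_transfer T1 T2 (qr psi)) with (r := qr psi); auto.
  split; [|split].
  - intros t ->. exists (empty_asg _); split; auto. apply empty_equiv; auto.
  - intros s ->. exists (empty_asg _); split; auto. apply empty_equiv; auto.
  (* Related assignments have the same domain, so only the empty one is isomorphic to the empty
     one. *)
  - intros t t' -> (p & _ & H). apply functional_extensionality; intros x.
    specialize (H x). simpl in H. destruct (t' x); [contradiction|auto].
Qed.

End Structures.

Lemma inc_bound_mono (tau : signature) (phi : formula tau) m n :
  (m <= n)%nat -> inc_bound m phi -> inc_bound n phi.
Proof. intros Hmn; induction phi; simpl; intuition lia. Qed.

Lemma equivalent_refl (tau : signature) (phi : formula tau) : equivalent phi phi.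
Proof. intros M; tauto. Qed.

(** * Blocks of existential quantifiers in team semantics *)

Section ExistentialPrefix.
Context {tau : signature}.

Fixpoint exs (vs : list nat) (phi : formula tau) : formula tau :=
  match vs with [] => phi | x :: vs => FEx x (exs vs phi) end.

Lemma wf_exs vs phi : wf phi -> wf (exs vs phi).
Proof. induction vs; simpl; auto. Qed.

Lemma inc_bound_exs m vs phi : inc_bound m phi -> inc_bound m (exs vs phi).
Proof. induction vs; simpl; auto. Qed.

Lemma free_exs x vs phi : free x (exs vs phi) -> ~ In x vs /\ free x phi.
Proof. induction vs as [|y vs IH]; simpl; [tauto|]. intros [Hne H]; intuition congruence. Qed.

Variable M : model tau.

Fixpoint updates (s : assignment M) (vs : list nat) (l : list (carrier M)) : assignment M :=
  match vs, l with
  | x :: vs, a :: l => updates (update s x a) vs l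
  | _, _ => s
  end.

Lemma updates_other s vs l x : ~ In x vs -> updates s vs l x = s x.
Proof.
  revert s l; induction vs as [|y vs IH]; intros s [|a l] H; simpl in *; auto.
  rewrite IH by tauto. unfold update. destruct (Nat.eqb_spec x y); [subst; tauto|auto].
Qed.

Lemma map_updates s vs l :
  NoDup vs -> length l = length vs -> map (updates s vs l) vs = map Some l.
Proof.
  intros H; revert s l; induction H as [|x vs Hx _ IH]; intros s [|a l] Hl;
    try discriminate; auto.
  injection Hl as Hl. simpl. rewrite (IH _ _ Hl), updates_other by auto.
  unfold update. rewrite Nat.eqb_refl; auto.
Qed.

(** At each quantifier the choice set consists of the values that can still be completed to a member
    of [Y]. *)
Lemma sat_exs_intro vs phi (X Y : team M) :
  (forall s, X s -> exists l, length l = length vs /\ Y (updates s vs l)) ->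
  (forall t, Y t -> exists s l, X s /\ length l = length vs /\ t = updates s vs l) ->
  sat Y phi -> sat X (exs vs phi).
Proof.
  revert X; induction vs as [|x vs IH]; intros X H1 H2 HY; simpl.
  - replace X with Y; auto. apply functional_extensionality; intros s.
    apply propositional_extensionality; split; intros Hs.
    + destruct (H2 s Hs) as (s' & l & Hs' & _ & ->); auto.
    + destruct (H1 s Hs) as (l & _ & Hl); auto.
  - exists (fun s a => exists l, length l = length vs /\ Y (updates (update s x a) vs l)).
    split.
    + intros s Hs. destruct (H1 s Hs) as ([|a l] & Hl & HYl); [discriminate|].
      injection Hl as Hl. exists a, l; auto.
    + apply IH; auto.
      * intros s1 (s & a & Hs & Ha & ->); exact Ha.
      * intros t Ht. destruct (H2 t Ht) as (s & [|a l] & Hs & Hl & ->); [discriminate|].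
        injection Hl as Hl. exists (update s x a), l; split; [|split; auto].
        exists s, a; split; [auto|split; auto]. exists l; auto.
Qed.

Lemma sat_exs_elim vs phi (X : team M) :
  (exists s, X s) -> sat X (exs vs phi) -> exists Y : team M, (exists t, Y t) /\ sat Y phi.
Proof.
  revert X; induction vs as [|x vs IH]; intros X [s Hs] HX; simpl in HX; [eauto|].
  destruct HX as (F & HF & HX). apply (IH _) in HX; auto.
  destruct (HF s Hs) as [a Ha]. eauto 6.
Qed.

End ExistentialPrefix.

(** * The separating sentence and its truth in the two models *)

Definition infinite_path (k : nat) : formula (edge_sig k) :=
  exs (seq 0 (2 * k))
    (FAnd (@FRel (edge_sig k) tt (map TVar (seq 0 (2 * k)))) (FInc (seq k k) (seq 0 k))).

Lemma infinite_path_sentence k : FOinc_sentence k (infinite_path k).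
Proof.
  split; [|split].
  - apply wf_exs; simpl; repeat split.
    + rewrite length_map, length_seq; auto.
    + apply Forall_forall; intros t Ht. apply in_map_iff in Ht as (x & <- & _); exact I.
    + rewrite !length_seq; auto.
  - intros x Hx. apply free_exs in Hx as [Hn [Hf|Hf]]; apply Hn.
    + apply Exists_exists in Hf as (t & Ht & Ho). apply in_map_iff in Ht as (y & <- & Hy).
      simpl in Ho; subst; auto.
    + destruct Hf as [Hf|Hf]; apply in_seq in Hf; apply in_seq; lia.
  - apply inc_bound_exs; simpl. rewrite length_seq; auto.
Qed.

Lemma edge_app {D : Type} {T : chain} (k : nat) (col : list D -> T) xs ys :
  length xs = k -> length ys = k ->
  (edge k col (xs ++ ys) <-> NoDup xs /\ NoDup ys /\ off (col xs) (col ys) (-1)).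
Proof.
  intros Hx Hy. unfold edge.
  rewrite firstn_app, skipn_app, length_app, <- Hx, Nat.sub_diag, firstn_all, skipn_all.
  simpl. rewrite app_nil_r. intuition lia.
Qed.

Lemma seq_double k : seq 0 (2 * k) = seq 0 k ++ seq k k.
Proof. simpl. rewrite Nat.add_0_r. apply seq_app. Qed.

(** A new element prescribes [c] for the tuple made of itself and [k - 1] distinct elements. The
    tuple has to contain the new element, hence [1 <= k]. *)
Lemma generic_realizes {D T : Type} (col : list D -> T) k c :
  (1 <= k)%nat -> generic col -> exists w, length w = k /\ NoDup w /\ col w = c.
Proof.
  intros Hk Hg.
  assert (Hlong : forall n, exists w : list D, length w = n /\ NoDup w).
  { induction n as [|n (w & Hl & Hn)]; [exists []; split; [auto|constructor]|].
    destruct (Hg w []) as (d & Hd & _); try contradiction.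
    exists (d :: w); simpl; split; [auto|constructor; auto]. }
  destruct (Hlong (k - 1)%nat) as (w & Hl & Hn).
  destruct (Hg w [(None :: map Some w, c)]) as (d & Hd & Hc).
  - intros key t e [E|[]] He. injection E as <- <-.
    destruct He as [He|He]; [discriminate|]. apply in_map_iff in He as (? & E & ?). congruence.
  - intros key t t' [E|[]] [E'|[]]. congruence.
  - exists (d :: w); split; [simpl; lia|split; [constructor; auto|]].
    rewrite <- (Hc (None :: map Some w) c); simpl; auto.
    rewrite map_map; simpl. rewrite map_id; auto.
Qed.

Lemma app_inj_length {D : Type} (a b c d : list D) :
  length a = length c -> a ++ b = c ++ d -> a = c /\ b = d.
Proof.
  revert c; induction a as [|x a IH]; intros [|y c] Hl E; try discriminate; auto.
  injection Hl as Hl. injection E as <- E. destruct (IH c Hl E) as [<- <-]; auto.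
Qed.

Lemma infinite_path_true k :
  (1 <= k)%nat -> true_in (edge_model k half_line_plus_line) (infinite_path k).
Proof.
  intros Hk. set (M := edge_model k half_line_plus_line).
  set (col := colour half_line_plus_line org).
  pose proof (colour_generic half_line_plus_line org) as Hg.
  (* The team of all edges whose colours lie in the [Z] component, where descent never stops. *)
  set (Y := fun t : assignment M => exists (xs ys : list (carrier M)) z,
         length xs = k /\ length ys = k /\ NoDup xs /\ NoDup ys /\
         col xs = inr z /\ col ys = inr (z - 1) /\
         t = updates M (empty_asg M) (seq 0 (2 * k)) (xs ++ ys)).
  assert (HY : forall (xs ys : list (carrier M)), length xs = k -> length ys = k ->
     map (updates M (empty_asg M) (seq 0 (2 * k)) (xs ++ ys)) (seq 0 k ++ seq k k)
     = map Some (xs ++ ys)).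
  { intros xs ys Hx Hy. rewrite <- seq_double. apply map_updates; [apply seq_NoDup|].
    rewrite length_app, length_seq; lia. }
  apply (sat_exs_intro M _ _ _ Y).
  - intros s ->.
    destruct (generic_realizes _ k (inr 0) Hk Hg) as (xs & Lx & Nx & Cx).
    destruct (generic_realizes _ k (inr (0 - 1)) Hk Hg) as (ys & Ly & Ny & Cy).
    exists (xs ++ ys); split; [rewrite length_app, length_seq; lia|].
    exists xs, ys, 0; auto 10.
  - intros t (xs & ys & z & Lx & Ly & _ & _ & _ & _ & ->).
    exists (empty_asg M), (xs ++ ys); split; [auto|split; [|auto]].
    rewrite length_app, length_seq; lia.
  - split.
    + intros t (xs & ys & z & Lx & Ly & Nx & Ny & Cx & Cy & ->).
      exists (xs ++ ys); split.
      * apply evals_vars. rewrite seq_double at 2. apply HY; auto.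
      * apply edge_app; auto. split; [auto|split; [auto|]].
        fold col. rewrite Cx, Cy. simpl. lia.
    + intros t (xs & ys & z & Lx & Ly & Nx & Ny & Cx & Cy & ->).
      (* The edge from [xs] to [ys] is continued by a [zs] one colour below [ys]. *)
      destruct (generic_realizes _ k (inr (z - 1 - 1)) Hk Hg) as (zs & Lz & Nz & Cz).
      exists (updates M (empty_asg M) (seq 0 (2 * k)) (ys ++ zs)); split.
      * exists ys, zs, (z - 1); auto 10.
      * pose proof (HY xs ys Lx Ly) as E. pose proof (HY ys zs Ly Lz) as E'.
        rewrite !map_app in E, E'.
        apply app_inj_length in E as [_ E]; [|rewrite !length_map, length_seq; auto].
        apply app_inj_length in E' as [E' _]; [|rewrite !length_map, length_seq; auto].
        rewrite E, E'; reflexivity.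
Qed.

Lemma map_Some_inj {D : Type} (l l' : list D) : map Some l = map Some l' -> l = l'.
Proof.
  revert l'; induction l as [|a l IH]; intros [|a' l'] E; try discriminate; auto.
  injection E as <- E. f_equal; auto.
Qed.

Lemma infinite_path_false k :
  ~ true_in (edge_model k half_line) (infinite_path k).
Proof.
  set (M := edge_model k half_line). set (col := colour half_line org).
  intros H. apply sat_exs_elim in H as (Y & [t Ht] & HE & HI); [|exists (empty_asg M); auto].
  assert (Hstep : forall t, Y t -> exists xs ys,
            map t (seq 0 k) = map Some xs /\ map t (seq k k) = map Some ys /\
            off (col xs) (col ys) (-1)).
  { clear t Ht; intros t Ht. destruct (HE t Ht) as (l & El & Hl).
    apply (proj1 (evals_vars _ _ t _ _)) in El. rewrite seq_double, map_app in El.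
    symmetry in El. apply map_eq_app in El as (xs & ys & -> & Ex & Ey).
    exists xs, ys; split; [auto|split; [auto|]].
    pose proof (f_equal (@length _) Ex) as Lx. pose proof (f_equal (@length _) Ey) as Ly.
    rewrite !length_map, length_seq in Lx, Ly.
    apply edge_app in Hl; auto. apply Hl. }
  (* The inclusion atom continues every edge by another one, and along edges the colour, a natural
     number, drops by one each time. *)
  assert (Hdesc : forall m t xs, Y t -> map t (seq 0 k) = map Some xs -> col xs = m -> False).
  { clear t Ht. intros m. change nat in m. induction m as [|m IH]; intros t xs Ht Ex Em;
      destruct (Hstep t Ht) as (xs' & ys & Ex' & Ey & Hoff);
      assert (xs' = xs) as -> by (apply map_Some_inj; rewrite <- Ex; auto);
      rewrite Em in Hoff.
    - change (Z.of_nat (col ys) = -1) in Hoff; lia.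
    - change (Z.of_nat (col ys) = Z.of_nat (S m) + -1) in Hoff.
      destruct (HI t Ht) as (t' & Ht' & E).
      apply (IH t' ys Ht'); [rewrite <- E; auto|]. apply Nat2Z.inj. lia. }
  destruct (Hstep t Ht) as (xs & ys & Ex & _). eauto.
Qed.

Local Close Scope Z_scope.

Theorem theorem6 (k : nat) (hk : 2 <= k) :
  (forall (tau : signature) (phi : formula tau),
      FOinc_sentence (k - 1) phi ->
      exists psi : formula tau, FOinc_sentence k psi /\ equivalent phi psi) /\
  (exists (tau : signature) (phi : formula tau),
      FOinc_sentence k phi /\
      forall psi : formula tau, FOinc_sentence (k - 1) psi -> ~ equivalent phi psi).
Proof.
  split.
  - intros tau phi (Hwf & Hs & Hi). exists phi; split; [|apply equivalent_refl].
    split; [auto|split; [auto|]]. apply (inc_bound_mono _ _ (k - 1)); auto; lia.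
  - exists (edge_sig k), (infinite_path k). split; [apply infinite_path_sentence|].
    (* An equivalent [psi] would hold over the half line plus line, hence by transfer over the half
       line, where the sentence fails. *)
    intros psi (_ & _ & Hi) Heq. apply (infinite_path_false k), Heq.
    apply (true_in_transfer k half_line_plus_line); [lia|auto|].
    apply Heq, infinite_path_true; lia.
Qed.
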